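(* Let $(X,f)$ be a dynamical system. Suppose that (1) $f$ is quasi-continuous and $\delta$-open, and (2) $X$ is fragmented by a metric $\rho$ such that the topology generated by $\rho$ contains the topology of the space $X$. Then $C^{\infty}_f$ is a residual set in $X$. Furthermore, if $X$ is also a Baire space, then $C^{\infty}_f$ contains a dense $G_\delta$-set.
   Context: $\mathbb N$ denotes the set of nonnegative integers. A dynamical system is a pair $(X,f)$ where $X$ is a topological space (with at least two points) and $f:X\to X$ is a map, not necessarily continuous. A map $g:Y\to Z$ between topological spaces is quasi-continuous if for every $y_0\in Y$, every open neighbourhood $W$ of $g(y_0)$ and every open neighbourhood $U$ of $y_0$, there is a nonempty open set $V\subseteq U$ with $g(V)\subseteq W$. A map $g:Y\to Z$ is $\delta$-open if for every nowhere dense subset $N$ of $Z$, $g^{-1}(N)$ is nowhere dense in $Y$. $C(f)$ is the set of points of $X$ at which $f$ is continuous, and $C^{\infty}_f=\{x\in X: f^n(x)\in C(f)\text{ for all } n\in\mathbb N\}$. Let $\rho$ be a metric on the set $X$. The topological space $X$ is fragmented by $\rho$ if for every $\epsilon>0$ and every nonempty $A\subseteq X$ there is a nonempty $B\subseteq A$, relatively open in $A$ (for the topology of $X$), with $\rho$-diameter of $B$ less than $\epsilon$. A subset $R\subseteq X$ is residual if $X\setminus R$ is a countable union of nowhere dense subsets of $X$. *)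

(* Defs.v *)
From mathcomp Require Import all_boot all_order all_algebra.
From mathcomp Require Import all_classical all_reals ereal topology sequences.

Set Implicit Arguments.
Unset Strict Implicit.
Unset Printing Implicit Defensive.

Import Order.TTheory GRing.Theory Num.Theory.

Local Open Scope classical_set_scope.
Local Open Scope ring_scope.

Definition nowhere_dense (X : topologicalType) (N : set X) : Prop :=
  interior (closure N) = set0.

Definition residual (X : topologicalType) (A : set X) : Prop :=
  exists2 N : (set X)^nat,
    (forall i, nowhere_dense (N i)) & ~` A = \bigcup_i N i.

Definition baire_space (X : topologicalType) : Prop :=
  forall F : (set X)^nat,
    (forall i, open (F i) /\ dense (F i)) -> dense (\bigcap_i F i).

Definition quasi_continuous (Y Z : topologicalType) (g : Y -> Z) : Prop :=
  forall (y0 : Y) (W : set Z) (U : set Y),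
    open W -> W (g y0) -> open U -> U y0 ->
    exists V : set Y, [/\ open V, V !=set0, V `<=` U & g @` V `<=` W].

Definition delta_open (Y Z : topologicalType) (g : Y -> Z) : Prop :=
  forall N : set Z, nowhere_dense N -> nowhere_dense (g @^-1` N).

Definition continuity_points (X : topologicalType) (f : X -> X) : set X :=
  [set x | {for x, continuous f}].

Definition orbit_continuity_points (X : topologicalType) (f : X -> X) : set X :=
  [set x | forall n : nat, continuity_points f (iter n f x)].

(* The metric is an explicit function rather than a [metricType] structure:
   the carrier already has a topology, which need not be the metric one. *)
Record is_metric (R : realType) (X : Type) (rho : X -> X -> R) : Prop := {
  metric_ge0 : forall x y, 0 <= rho x y ;
  metric_eq0 : forall x y, rho x y = 0 <-> x = y ;
  metric_symmetric : forall x y, rho x y = rho y x ;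
  metric_triangular : forall x y z, rho x z <= rho x y + rho y z }.

Definition metric_open (R : realType) (X : Type) (rho : X -> X -> R)
    (U : set X) : Prop :=
  forall x, U x -> exists2 r : R, 0 < r & [set y | rho x y < r] `<=` U.

(* Extended-real valued, so that an unbounded set has diameter +oo (and the
   empty set has diameter -oo; it is only used on nonempty sets). *)
Definition diameter (R : realType) (X : Type) (rho : X -> X -> R)
    (B : set X) : \bar R :=
  ereal_sup [set (rho p.1 p.2)%:E | p in B `*` B].

Definition fragmented_by (R : realType) (X : topologicalType)
    (rho : X -> X -> R) : Prop :=
  forall (e : R) (A : set X), 0 < e -> A !=set0 ->
    exists B : set X,
      [/\ B !=set0,
          B `<=` A,
          (exists2 U : set X, open U & B = A `&` U)
        & (diameter rho B < e%:E)%E].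

(* Main.v *)
Require Import Defs.
From mathcomp Require Import all_boot all_order all_algebra.
From mathcomp Require Import all_classical all_reals topology borel_hierarchy.
From mathcomp Require Import ereal.

(** Call a point [e]-good when some open neighbourhood of it is mapped by [f]
    into a set whose points are pairwise less than [e] apart for [rho].  The
    [e]-good points form an open set, and it is dense: inside the image [f @` U]
    of a nonempty open [U], fragmentation finds a nonempty relatively open
    piece of diameter less than [e], and quasi-continuity then finds a nonempty
    open [V `<=` U] mapped into that piece ([dense_small_image_points]).

    As every open set is open for [rho], a point that is [n.+1%:R^-1]-good for
    all [n] is a continuity point of [f] ([small_image_points_continuity]).
    Hence the points whose orbit meets a discontinuity of [f] are covered by
    the preimages, under the iterates of [f], of countably many closed nowhere
    dense sets.  These preimages are nowhere dense because [delta_open] passes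
    to iterates, which gives residuality.  In a Baire space the complements of
    the closures of countably many nowhere dense sets intersect in a dense
    G-delta set ([residual_Gdelta]). *)

Import Order.TTheory GRing.Theory Num.Theory.

Local Open Scope classical_set_scope.

Section category.
Context {X : topologicalType}.
Implicit Types (A N O : set X).

Lemma nowhere_dense_subset N A :
  N `<=` A -> nowhere_dense A -> nowhere_dense N.
Proof.
rewrite /nowhere_dense => NA A0; rewrite -subset0 -A0.
exact/interiorS/closureS.
Qed.

Lemma nowhere_denseC_dense N : nowhere_dense N -> dense (~` closure N).
Proof.
rewrite /nowhere_dense => N0 U [x Ux] oU; apply: contrapT => h.
suff : interior (closure N) x by rewrite N0.
rewrite /interior; apply: (filterS _ (open_nbhs_nbhs (conj oU Ux))).
by move=> y Uy; apply: contrapT => Ny; apply: h; exists y.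
Qed.

Lemma open_denseC_nowhere_dense O :
  open O -> dense O -> nowhere_dense (~` O).
Proof.
move=> oO dO; rewrite /nowhere_dense.
have <- : ~` O = closure (~` O) by apply/closure_id/open_closedC.
rewrite -subset0 => x Ox.
have [] := dO (interior (~` O)); [by exists x|exact: open_interior|].
by move=> y [/interior_subset].
Qed.

(** [residual] asks for an exact description of the complement; intersecting
    the members of any countable nowhere dense cover with it provides one. *)
Lemma residual_cover A (N : nat -> set X) :
  (forall i, nowhere_dense (N i)) -> ~` A `<=` \bigcup_i N i -> residual A.
Proof.
move=> Nnd AN; exists (fun i => N i `&` ~` A).
  by move=> i; apply: (nowhere_dense_subset _ _ (@subIsetl _ _ _)).
by rewrite -setI_bigcupl; apply/esym/setIidPr.
Qed.

Lemma residual_Gdelta A : baire_space X -> residual A ->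
  exists G : set X, [/\ Gdelta G, dense G & G `<=` A].
Proof.
move=> baireX [N Nnd AN].
have oF i : open (~` closure (N i)) by exact/closed_openC/closed_closure.
exists (\bigcap_i ~` closure (N i)); split.
- by exists (fun i => ~` closure (N i)).
- by apply: baireX => i; split=> //; exact: nowhere_denseC_dense.
- move=> x Gx; apply: contrapT => /= nAx.
  have : (~` A) x by [].
  by rewrite AN => -[i _ Nx]; apply: (Gx i I); exact: subset_closure.
Qed.

Lemma delta_open_iter (f : X -> X) k : delta_open f -> delta_open (iter k f).
Proof.
move=> df; elim: k => [|k IH] N Nnd; first exact: Nnd.
exact: IH (df _ Nnd).
Qed.

End category.

Section small_images.
Local Open Scope ring_scope.
Context {R : realType} {X : topologicalType}.
Variables (f : X -> X) (rho : X -> X -> R).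

(** Essentially the points where the [rho]-oscillation of [f] is less than [e];
    bounding pairwise distances instead of a diameter keeps extended reals
    out. *)
Definition small_image_points (e : R) : set X :=
  [set x | exists U : set X,
    [/\ open U, U x & forall y z, U y -> U z -> rho (f y) (f z) < e]].

Lemma open_small_image_points e : open (small_image_points e).
Proof.
rewrite openE => x [U [oU Ux Ue]].
apply: (filterS _ (open_nbhs_nbhs (conj oU Ux))) => y Uy.
by exists U.
Qed.

Lemma diameter_lt (B : set X) e y z :
  (diameter rho B < e%:E)%E -> B y -> B z -> rho y z < e.
Proof.
move=> Be By Bz; rewrite -lte_fin; apply: le_lt_trans Be.
by apply: ereal_sup_ubound; exists (y, z).
Qed.

(** Fragmentation has to be applied to the image [f @` U], not to [U]: its
    relatively open piece is cut out by an open [W] of the target, which is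
    what quasi-continuity can aim at. *)
Lemma dense_small_image_points e :
  quasi_continuous f -> fragmented_by rho -> 0 < e ->
  dense (small_image_points e).
Proof.
move=> qf fragX e0 U [x0 Ux0] oU.
have [|B [[b Bb] BfU [W oW BE] Be]] := fragX e (f @` U) e0.
  by exists (f x0), x0.
have [[x Ux fxb] Wb] : (f @` U `&` W) b by rewrite -BE.
have [|V [oV [v Vv] VU fVW]] := qf x W U oW _ oU Ux; first by rewrite fxb.
exists v; split; first exact: VU.
have fVB y : V y -> B (f y).
  move=> Vy; rewrite BE; split; first by exists y => //; exact: VU.
  by apply: fVW; exists y.
by exists V; split=> // y z Vy Vz; apply: (diameter_lt _ _ _ _ Be); exact: fVB.
Qed.

(** Closeness of the images is known for [rho] only; it gives continuity for
    the topology of [X] because each open neighbourhood of [f x] contains a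
    [rho]-ball around [f x]. *)
Lemma small_image_points_continuity :
  (forall U : set X, open U -> metric_open rho U) ->
  \bigcap_n small_image_points n.+1%:R^-1 `<=` continuity_points f.
Proof.
move=> finer x Sx A; rewrite nbhsE => -[W [oW Wfx] WA].
have [r r0 rW] := finer W oW _ Wfx.
have [n nr] : exists n : nat, n.+1%:R^-1 < r.
  exists (Num.bound r^-1); rewrite invf_plt ?posrE//.
  rewrite (lt_trans (archi_boundP _)) ?ltr_nat//.
  by rewrite invr_ge0 ltW.
have [U [oU Ux Un]] := Sx n I.
apply: (filterS _ (open_nbhs_nbhs (conj oU Ux))) => y Uy.
by apply/WA/rW; apply: lt_trans nr; exact: Un.
Qed.

Lemma residual_orbit_continuity_points :
  quasi_continuous f -> delta_open f -> fragmented_by rho ->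
  (forall U : set X, open U -> metric_open rho U) ->
  residual (orbit_continuity_points f).
Proof.
move=> qf df fragX finer.
pose N (p : nat * nat) : set X :=
  iter p.1 f @^-1` (~` small_image_points p.2.+1%:R^-1).
have Nnd p : nowhere_dense (N p).
  apply: (delta_open_iter f p.1 df); apply: open_denseC_nowhere_dense.
    exact: open_small_image_points.
  by apply: dense_small_image_points => //; rewrite invr_gt0.
(* A sequence is wanted, so the pairs are enumerated by their codes;
   an integer that codes no pair receives the default pair. *)
apply: (residual_cover _ (fun i => N (odflt (0, 0)%N (unpickle i)))) => //.
move=> x; apply: contra_notP => nN k.
apply: (small_image_points_continuity finer) => n _; apply: contrapT => nS.
by apply: nN; exists (pickle (k, n)) => //=; rewrite pickleK.
Qed.

End small_images.

Theorem proposition3p8 (R : realType) (X : topologicalType) (f : X -> X)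
    (rho : X -> X -> R)
    (two_points : exists x y : X, x <> y)
    (f_quasi_continuous : quasi_continuous f)
    (f_delta_open : delta_open f)
    (rho_metric : is_metric rho)
    (X_fragmented : fragmented_by rho)
    (rho_finer : forall U : set X, open U -> metric_open rho U) :
  residual (orbit_continuity_points f) /\
  (baire_space X ->
   exists G : set X,
     [/\ Gdelta G, dense G & G `<=` orbit_continuity_points f]).
Proof.
have res : residual (orbit_continuity_points f).
  exact: (residual_orbit_continuity_points f rho).
by split=> // baireX; exact: residual_Gdelta.
Qed.
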